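(* For $s>2$ let $f_s:(0,+\infty)\to\mathbb{R}$, $f_s(r)=r^{-s}$. Then $\mathsf{A}_2$ is locally optimal for every $f_s$ with $s>2$, uniformly for $s$ in compact subsets of $(2,+\infty)$: for every compact set $K\subset(2,+\infty)$ there exists $\epsilon>0$ such that for every $s\in K$ and every map $\mathbf{p}:\mathsf{A}_2\to\mathbb{R}^2$ with $\|\mathbf{p}\|\le\epsilon$, $$\mathrm{E}_{f_s}(\mathsf{A}_2+\mathbf{p})\ge\mathrm{E}_{f_s}(\mathsf{A}_2).$$
   Context: Hexagonal lattice: $r_\star:=\sqrt{2/\sqrt3}$, $\sigma:=r_\star(1,0)$, $\tau:=r_\star(\tfrac12,\tfrac{\sqrt3}{2})$, and $\mathsf{A}_2:=\sigma\mathbb{Z}+\tau\mathbb{Z}\subset\mathbb{R}^2$ (covolume $1$). Energy: for $f:(0,+\infty)\to\mathbb{R}$ and a locally finite set $\mathsf{X}\subset\mathbb{R}^2$, $$\mathrm{E}_f(\mathsf{X}):=\liminf_{r\to\infty}\frac{1}{|\mathsf{X}\cap \mathrm{B}_r|}\sum_{x,y\in \mathsf{X}\cap \mathrm{B}_r,\ x\ne y} f(|x-y|),$$ where $\mathrm{B}_r$ is the disk of center $0$ and radius $r$, $|\mathsf{X}\cap\mathrm{B}_r|$ is the number of points, and the sum is over ordered pairs. Perturbations: for $\mathbf{p}:\mathsf{A}_2\to\mathbb{R}^2$, $\mathsf{A}_2+\mathbf{p}:=\{x+\mathbf{p}(x):x\in\mathsf{A}_2\}$ and $\|\mathbf{p}\|:=\sup_{x\in\mathsf{A}_2}|\mathbf{p}(x)|$.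 *)

(* Defs.v *)
From HB Require Import structures.
From mathcomp Require Import all_boot all_order all_algebra.
From mathcomp Require Import finmap.
From mathcomp Require Import all_classical all_reals all_analysis.

Set Implicit Arguments.
Unset Strict Implicit.
Unset Printing Implicit Defensive.

Import Order.TTheory GRing.Theory Num.Theory.
Import numFieldNormedType.Exports.

Local Open Scope classical_set_scope.
Local Open Scope ring_scope.

(* The library's norm `|x| on row vectors is the sup norm; distances below are
   Euclidean. *)
Definition eucl_norm (R : realType) (x : 'rV[R]_2) : R :=
  Num.sqrt (\sum_(i < 2) x ord0 i ^+ 2).

Definition disk (R : realType) (r : R) : set 'rV[R]_2 :=
  [set x | eucl_norm x <= r].

Definition vec2 (R : realType) (a b : R) : 'rV[R]_2 :=
  \row_(i < 2) (if i == ord0 then a else b).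

Definition r_star (R : realType) : R := Num.sqrt (2 / Num.sqrt 3).

Definition sigma_vec (R : realType) : 'rV[R]_2 := r_star R *: vec2 1 0.

Definition tau_vec (R : realType) : 'rV[R]_2 :=
  r_star R *: vec2 (1 / 2) (Num.sqrt 3 / 2).

Definition hex_lattice (R : realType) : set 'rV[R]_2 :=
  [set x | exists m n : int,
     x = m%:~R *: sigma_vec R + n%:~R *: tau_vec R].
Arguments hex_lattice : clear implicits.

(* Meaningful when [X `&` disk r] is finite, as it is for every r when X is
   locally finite. The sum is over ordered pairs of distinct points, so f is
   only evaluated on positive reals. If [X `&` disk r] is empty the value is
   0 / 0 = 0; for nonempty X this does not affect the limit r -> +oo. *)
Definition energy_in_disk (R : realType) (f : R -> R) (X : set 'rV[R]_2)
    (r : R) : R :=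
  (\sum_(x \in X `&` disk r) \sum_(y \in (X `&` disk r) `\ x)
      f (eucl_norm (x - y)))
  / (#|` fset_set (X `&` disk r)|)%:R.

Definition energy (R : realType) (f : R -> R) (X : set 'rV[R]_2) : \bar R :=
  limf_einf (fun r : R => (energy_in_disk f X r)%:E) (pinfty_nbhs R).

(* A map from the lattice to the plane is represented by a total map of the
   plane; only its values on the lattice are used in the next two notions. *)
Definition perturbed_lattice (R : realType) (p : 'rV[R]_2 -> 'rV[R]_2) :
    set 'rV[R]_2 :=
  [set x + p x | x in hex_lattice R].

Definition perturbation_norm (R : realType) (p : 'rV[R]_2 -> 'rV[R]_2) :
    \bar R :=
  ereal_sup [set (eucl_norm (p x))%:E | x in hex_lattice R].

Definition inverse_power (R : realType) (s r : R) : R := r `^ (- s).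

(* Main.v *)
Require Import Defs.
From mathcomp Require Import all_boot all_order all_algebra.
From mathcomp Require Import finmap ring lra zify.
From mathcomp Require Import all_classical all_reals all_analysis.
Import Order.TTheory GRing.Theory Num.Theory.
Import numFieldNormedType.Exports.
Local Open Scope classical_set_scope.
Local Open Scope ring_scope.

(** Write b = s / 2, so that a pair at squared distance a contributes a^(-b).

The heart of the proof is an inequality for one triangle.  Let a triangle be
close to an equilateral one of squared side N, with squared sides N (1 + t_i),
and let alpha be its signed area divided by the equilateral area.  Then
  sum_i (1 + t_i)^(-b) >= 3 - 3 b (alpha - 1)
as soon as b > 1, that is s > 2: by Heron's formula alpha - 1 equals
(sum t_i) / 3 - (sum t_i^2) / 3 + (sum t_i)^2 / 9 to second order, so the two
sides differ by at least (b (b + 1) / 2 - b) sum t_i^2 to that order, and this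
coefficient is positive exactly when b > 1
([triangle_inequality_normalized]).  The smallness of the t_i that is required
depends only on a lower bound b0 > 1 of b, which compactness of the set of
exponents provides.  It is also scale invariant: displacements of size eps
change a squared side N >= 1 by at most a multiple of eps N, so one eps serves
all the distances in the lattice.

For every nonzero lattice vector v and every lattice point x apply this to the
perturbed triangle x, x + v, x + omega v, where omega is the rotation by 60
degrees.  Summed over x and over a finite set of v stable under omega, the
sides give three times the pair energy, while the area is a null Lagrangian:
the increments of the areas telescope ([mean_null_triangle_areas]).  Hence, up
to boundary terms, the energy per point of the perturbed lattice restricted to
distances at most a given bound is at least that of the lattice
([mean_inverse_power_ge]).  The interactions are positive, so this truncation
only lowers the perturbed energy, and the truncated lattice sums dominate the
lattice energy in each disk ([hex_energy_in_disk_le]).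

Boundary terms are negligible because the indices of the points in a disk form
a Foelner family: a lattice annulus of bounded width contains O(r^(3/2))
points ([card_annulus]), a disk at least a multiple of r^2. *)

(** * An inequality for nearly equilateral triangles *)

(** ln (1 + t) is twice the logarithm of the square root of 1 + t, and
ln q <= q - 1 applied to the square root already sees the quadratic term. *)
Lemma ln1D_le_quadratic {R : realType} (t : R) :
  `|t| <= 1 / 2 -> ln (1 + t) <= t - t ^+ 2 / 8.
Proof.
rewrite ler_norml => /andP[t1 t2].
have s0 : 0 < 1 + t by lra.
have q0 : 0 < Num.sqrt (1 + t) by rewrite sqrtr_gt0.
have qE : Num.sqrt (1 + t) ^+ 2 = 1 + t by rewrite sqr_sqrtr // ltW.
have lnq : ln (1 + t) <= 2 * (Num.sqrt (1 + t) - 1).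
  rewrite -{1}qE lnXn // mulr2n.
  have := @le_ln1Dx R (Num.sqrt (1 + t) - 1).
  rewrite addrCA subrr addr0 => /(_ _) H.
  have : ln (Num.sqrt (1 + t)) <= Num.sqrt (1 + t) - 1 by apply: H; lra.
  lra.
apply: le_trans lnq _.
suff : Num.sqrt (1 + t) <= 1 + t / 2 - t ^+ 2 / 16 by lra.
have p0 : 0 <= 1 + t / 2 - t ^+ 2 / 16 by nra.
rewrite -(ler_pXn2r (n := 2)) ?nnegrE ?(ltW q0) // qE.
nra.
Qed.

(** What matters is that the coefficient of t^2 exceeds b; its Taylor value is
b (b + 1) / 2.  With c = b - 1, the power is (1 + t)^-1 times
exp (- c ln (1 + t)), and the second factor is at least
1 - c (t - t^2 / 8). *)
Lemma powRN_ge_quadratic {R : realType} (b t : R) :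
  1 < b -> b <= 2 -> `|t| <= (b - 1) / 48 ->
  1 - b * t + (b + (b - 1) / 16) * t ^+ 2 <= (1 + t) `^ (- b).
Proof.
move=> b1 b2 tb.
have tln : ln (1 + t) <= t - t ^+ 2 / 8.
  by apply: ln1D_le_quadratic; apply: le_trans tb _; lra.
move: tb; rewrite ler_norml => /andP[t1 t2].
have s0 : 0 < 1 + t by lra.
have -> : (1 + t) `^ (- b) = (1 + t)^-1 * (1 + t) `^ (- (b - 1)).
  rewrite -(powR_inv1 (ltW s0)) -powRD; first by congr (_ `^ _); ring.
  by rewrite (gt_eqF s0) implybT.
rewrite [leRHS]mulrC ler_pdivlMr //.
have expo : 1 - (b - 1) * (t - t ^+ 2 / 8) <= (1 + t) `^ (- (b - 1)).
  rewrite /powR gt_eqF //.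
  apply: le_trans (expR_ge1Dx _).
  have : 0 <= (b - 1) * (t - t ^+ 2 / 8 - ln (1 + t)) by apply: mulr_ge0; lra.
  lra.
apply: le_trans expo.
set c := b - 1.
have bE : b = c + 1 by rewrite /c; lra.
rewrite bE; rewrite -/c in t1 t2.
have c0 : 0 < c by rewrite /c; lra.
have c1 : c <= 1 by rewrite /c; lra.
have : 0 <= t ^+ 2 * (c / 16 - (c + 1 + c / 16) * t).
  apply: mulr_ge0; first exact: sqr_ge0.
  by nra.
lra.
Qed.

(** a^q = a a^(q - 1) >= a (1 + (q - 1) ln a), and a ln a >= a - 1. *)
Lemma bernoulli_powR {R : realType} (a q : R) :
  0 < a -> 1 <= q -> 1 + q * (a - 1) <= a `^ q.
Proof.
move=> a0 q1.
have -> : a `^ q = a * a `^ (q - 1).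
  by rewrite mulr_powRB1 ?(ltW a0) //; lra.
have h1 : 1 + (q - 1) * ln a <= a `^ (q - 1).
  by rewrite /powR gt_eqF // expR_ge1Dx.
have h2 : a - 1 <= a * ln a.
  have : ln (1 + (a^-1 - 1)) <= a^-1 - 1.
    have ai0 : 0 < a^-1 by rewrite invr_gt0.
    by apply: le_ln1Dx; lra.
  rewrite addrCA subrr addr0 lnV ?posrE // => h.
  have := ler_wpM2l (ltW a0) h.
  by rewrite mulrN mulrBr mulfV ?gt_eqF //; lra.
have h3 := ler_wpM2l (ltW a0) h1.
have h4 : (q - 1) * (a - 1) <= (q - 1) * (a * ln a) by apply: ler_wpM2l; lra.
by apply: le_trans h3; lra.
Qed.

(** The hypothesis on al is Heron's formula for a triangle of squared sides
1 + t_i whose area is al times that of the unit equilateral triangle.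
Bernoulli's inequality for the exponent b / b0 reduces b to b0; with
T = sum t_i and Q = sum t_i^2, the quadratic bound on the powers then leaves
al >= 1 + T / 3 - k Q for some k > 1 / 3, which is checked after squaring. *)
Lemma triangle_inequality_normalized {R : realType} (b0 b al t1 t2 t3 : R) :
  1 < b0 -> b0 <= 2 -> b0 <= b ->
  `|t1| <= (b0 - 1) / 200 -> `|t2| <= (b0 - 1) / 200 ->
  `|t3| <= (b0 - 1) / 200 ->
  0 < al ->
  3 * al ^+ 2 = (3 + (t1 + t2 + t3)) ^+ 2
                - 2 * ((1 + t1) ^+ 2 + (1 + t2) ^+ 2 + (1 + t3) ^+ 2) ->
  3 - 3 * b * (al - 1) <= (1 + t1) `^ (- b) + (1 + t2) `^ (- b)
                          + (1 + t3) `^ (- b).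
Proof.
move=> b01 b02 b0b h1 h2 h3 al0 alE.
have b0p : 0 < b0 by lra.
(* the bound for one side, transferred from the exponent b0 to b *)
have one t : `|t| <= (b0 - 1) / 200 ->
    1 + b / b0 * (- b0 * t + (b0 + (b0 - 1) / 16) * t ^+ 2)
      <= (1 + t) `^ (- b).
  move=> ht.
  have s0 : 0 < 1 + t by move: ht; rewrite ler_norml; lra.
  have -> : - b = - b0 * (b / b0).
    by rewrite mulNr mulrCA mulfV ?mulr1 // gt_eqF.
  rewrite powRrM.
  have q1 : 1 <= b / b0 by rewrite ler_pdivlMr // mul1r.
  apply: le_trans (bernoulli_powR _ _ (powR_gt0 _ s0) q1).
  have /(ler_wpM2l (le_trans ler01 q1)) :
      - b0 * t + (b0 + (b0 - 1) / 16) * t ^+ 2 <= (1 + t) `^ (- b0) - 1.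
    have := @powRN_ge_quadratic R b0 t b01 b02.
    have -> : `|t| <= (b0 - 1) / 48 by apply: le_trans ht _; lra.
    move=> /(_ isT); lra.
  lra.
have := one _ h1; have := one _ h2; have := one _ h3.
set T := t1 + t2 + t3; set Q := t1 ^+ 2 + t2 ^+ 2 + t3 ^+ 2.
have alT : 3 * al ^+ 2 = 3 + 2 * T + T ^+ 2 - 2 * Q.
  by rewrite alE /T /Q; ring.
have qb : b / b0 * b0 = b by rewrite divfK // gt_eqF.
have q0 : 0 <= b / b0 by apply: divr_ge0; lra.
suff key : 1 + T / 3 - (b0 + (b0 - 1) / 16) / (3 * b0) * Q <= al.
  have key3 : 3 * b0 + b0 * T - (b0 + (b0 - 1) / 16) * Q <= 3 * b0 * al.
    have := ler_wpM2l (ltW (mulr_gt0 (@ltr0Sn R 2) b0p)) key.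
    rewrite mulrBr mulrA mulrCA divff; last by rewrite gt_eqF //; lra.
    lra.
  have := ler_wpM2l q0 key3.
  have -> : b / b0 * (3 * b0 + b0 * T - (b0 + (b0 - 1) / 16) * Q) =
    (b / b0 * b0) * 3 + b / b0 * (b0 * T - (b0 + (b0 - 1) / 16) * Q) by ring.
  have -> : b / b0 * (3 * b0 * al) = (b / b0 * b0) * 3 * al by ring.
  rewrite qb /T /Q; lra.
move: h1 h2 h3; rewrite !ler_norml => /andP[a1 a2] /andP[a3 a4] /andP[a5 a6].
set d := (b0 - 1) / 200 in a1 a2 a3 a4 a5 a6.
have d0 : 0 < d by rewrite /d; lra.
have d1 : d <= 1 / 200 by rewrite /d; lra.
have b0E : b0 = 1 + 200 * d by rewrite /d; lra.
set k := (b0 + (b0 - 1) / 16) / (3 * b0).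
have kE : 3 * k * b0 = b0 + (b0 - 1) / 16.
  by rewrite /k; field; rewrite gt_eqF.
have k1 : 1 + 6 * d <= 3 * k.
  rewrite -(ler_pM2r b0p) kE b0E; nra.
have k2 : k <= 1.
  rewrite -(ler_pM2r b0p); nra.
have Q0 : 0 <= Q by rewrite /Q; nra.
have Q1 : Q <= d / 50 by rewrite /Q; nra.
have T1 : - (3 * d) <= T by rewrite /T; lra.
have T2 : T <= 3 * d by rewrite /T; lra.
have kQ : k * Q <= d / 50.
  have : k * Q <= 1 * Q by apply: ler_wpM2r.
  lra.
have kQ0 : 0 <= k * Q by apply: mulr_ge0 => //; lra.
have p0 : 0 <= 1 + T / 3 - k * Q by lra.
rewrite -(ler_pXn2r (n := 2)) ?nnegrE ?(ltW al0) //.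
have kk : 2 / 3 <= k * (2 + 2 * T / 3 - k * Q).
  have : 2 - 2 * d - d / 50 <= 2 + 2 * T / 3 - k * Q by lra.
  nra.
have := ler_wpM2r Q0 kk.
have T20 := sqr_ge0 T.
lra.
Qed.

(** * Geometry of the hexagonal lattice *)

Definition sqnorm {R : realType} (x : 'rV[R]_2) : R :=
  x 0 0 ^+ 2 + x 0 1 ^+ 2.

Definition cross {R : realType} (x y : 'rV[R]_2) : R :=
  x 0 0 * y 0 1 - x 0 1 * y 0 0.

(** The lattice is parametrized by its coordinates in the basis sigma, tau. *)
Definition hexpt {R : realType} (z : int * int) : 'rV[R]_2 :=
  z.1%:~R *: sigma_vec R + z.2%:~R *: tau_vec R.

(** The rotation by 60 degrees in these coordinates: sigma goes to tau and tau
to tau - sigma. *)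
Definition rot6 (z : int * int) : int * int := (- z.2, z.1 + z.2).

Lemma ord2_cases (i : 'I_2) : i = 0 \/ i = 1.
Proof. by case: i => [[|[|[]]]] //= ?; [left|right]; apply/val_inj. Qed.

Lemma eucl_normE {R : realType} (x : 'rV[R]_2) :
  eucl_norm x = Num.sqrt (sqnorm x).
Proof.
rewrite /eucl_norm /sqnorm !big_ord_recl big_ord0 addr0.
by congr (Num.sqrt (_ + x _ _ ^+ 2)); apply/val_inj.
Qed.

Lemma sqnorm_ge0 {R : realType} (x : 'rV[R]_2) : 0 <= sqnorm x.
Proof. by rewrite addr_ge0 ?sqr_ge0. Qed.

Lemma sqnormN {R : realType} (x : 'rV[R]_2) : sqnorm (- x) = sqnorm x.
Proof. by rewrite /sqnorm !mxE !sqrrN. Qed.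

Lemma disk_sqnorm {R : realType} (r : R) (x : 'rV[R]_2) :
  0 <= r -> disk r x <-> sqnorm x <= r ^+ 2.
Proof.
move=> r0; rewrite /disk /= eucl_normE.
by rewrite -{1}(ger0_norm r0) -sqrtr_sqr ler_sqrt ?sqr_ge0.
Qed.

Lemma inverse_powerE {R : realType} (s : R) (x : 'rV[R]_2) :
  inverse_power s (eucl_norm x) = sqnorm x `^ (- (s / 2)).
Proof.
rewrite /inverse_power eucl_normE -(powR12_sqrt (sqnorm_ge0 x)) -powRrM.
by congr (_ `^ _); ring.
Qed.

Lemma hexptD {R : realType} (z w : int * int) :
  hexpt (z + w) = hexpt z + hexpt w :> 'rV[R]_2.
Proof. by rewrite /hexpt /= !intrD !scalerDl addrACA. Qed.

Lemma hexptN {R : realType} (z : int * int) :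
  hexpt (- z) = - hexpt z :> 'rV[R]_2.
Proof. by rewrite /hexpt /= !intrN !scaleNr opprD. Qed.

Lemma hexpt_coordD {R : realType} (z w : int * int) i :
  hexpt (z + w) 0 i = hexpt z 0 i + hexpt w 0 i :> R.
Proof. by rewrite hexptD mxE. Qed.

Lemma hexpt_perturbed_sub {R : realType} (d : int * int -> 'rV[R]_2)
    (x v : int * int) :
  hexpt (x + v) + d (x + v) - (hexpt x + d x) = hexpt v + (d (x + v) - d x).
Proof. by rewrite hexptD opprD addrACA [hexpt x + _]addrC addrK. Qed.

Lemma sqrt3_gt0 {R : realType} : 0 < Num.sqrt 3 :> R.
Proof. by rewrite sqrtr_gt0; lra. Qed.

Lemma r_star_sqr {R : realType} : r_star R ^+ 2 * Num.sqrt 3 = 2.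
Proof.
rewrite /r_star sqr_sqrtr; last by rewrite divr_ge0 ?sqrtr_ge0 //; lra.
by rewrite divfK // gt_eqF // sqrt3_gt0.
Qed.

Lemma sqrt3_sqr {R : realType} : Num.sqrt 3 ^+ 2 = 3 :> R.
Proof. by rewrite sqr_sqrtr //; lra. Qed.

Lemma r_star_bounds {R : realType} : 1 <= r_star R ^+ 2 /\ r_star R ^+ 2 <= 4 / 3.
Proof.
have := @r_star_sqr R; have := @sqrt3_gt0 R; have := @sqrt3_sqr R.
move: (Num.sqrt 3) (r_star R ^+ 2) => w q w3 w0 qw.
have w2 : w <= 2 by nra.
have w1 : 3 / 2 <= w by nra.
by split; nra.
Qed.

Lemma hexpt_coord0 {R : realType} (z : int * int) :
  hexpt z 0 0 = r_star R * (z.1%:~R + z.2%:~R / 2).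
Proof. by rewrite /hexpt /sigma_vec /tau_vec /vec2 !mxE /=; ring. Qed.

Lemma hexpt_coord1 {R : realType} (z : int * int) :
  hexpt z 0 1 = r_star R * (Num.sqrt 3 / 2 * z.2%:~R).
Proof. by rewrite /hexpt /sigma_vec /tau_vec /vec2 !mxE /=; ring. Qed.

Lemma sqnorm_hexpt {R : realType} (z : int * int) :
  sqnorm (hexpt z) = r_star R ^+ 2 *
    ((z.1 ^+ 2 + z.1 * z.2 + z.2 ^+ 2)%:~R).
Proof.
rewrite /sqnorm hexpt_coord0 hexpt_coord1 !exprMn -mulrDr; congr (_ * _).
rewrite !intrD intrM !rmorphXn /= sqrt3_sqr.
by field.
Qed.

Lemma sqnorm_rot6 {R : realType} (z : int * int) :
  sqnorm (hexpt (rot6 z)) = sqnorm (hexpt z) :> R.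
Proof. by rewrite !sqnorm_hexpt /rot6 /=; congr (_ * _%:~R); ring. Qed.

Lemma rot6_rot6 (z : int * int) : rot6 (rot6 z) = rot6 z - z.
Proof. by case: z => m n; rewrite /rot6 /=; congr pair; rewrite /=; ring. Qed.

Lemma cross_rot6 {R : realType} (z : int * int) :
  cross (hexpt z) (hexpt (rot6 z)) = Num.sqrt 3 / 2 * sqnorm (hexpt z) :> R.
Proof.
rewrite sqnorm_hexpt /cross !hexpt_coord0 !hexpt_coord1 /rot6 /=.
rewrite !intrD intrM intrN !rmorphXn /=.
by field.
Qed.

(** The squared length is r_star^2 >= 1 times a positive integer. *)
Lemma sqnorm_hexpt_ge1 {R : realType} (z : int * int) :
  z != 0 -> 1 <= sqnorm (hexpt z) :> R.
Proof.
move=> z0; rewrite sqnorm_hexpt.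
have [r1 _] := @r_star_bounds R.
have : (1 : R) <= (z.1 ^+ 2 + z.1 * z.2 + z.2 ^+ 2)%:~R.
  rewrite -[1]/(1%:~R) ler_int.
  have [m0|m0] := eqVneq z.1 0; have [n0|n0] := eqVneq z.2 0.
  - by case: z z0 m0 n0 => ? ? /= z0 m0 n0; move: z0; rewrite m0 n0 eqxx.
  - rewrite m0; nia.
  - rewrite n0; nia.
  - nia.
move: (_%:~R) => q q1; nra.
Qed.

(** The bound is relative to N, hence uniform over all lattice vectors. *)
Lemma sqnorm_perturb {R : realType} (v u : 'rV[R]_2) (e N : R) :
  sqnorm v = N -> 1 <= N -> e <= 1 ->
  (forall i, `|u 0 i| <= e) ->
  `|sqnorm (v + u) / N - 1| <= 6 * e.
Proof.
move=> vN N1 e1 ue.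
have N0 : 0 < N by lra.
have -> : sqnorm (v + u) / N - 1 = (sqnorm (v + u) - N) / N.
  by field; exact: lt0r_neq0.
rewrite normrM (gtr0_norm (x := N^-1)) ?invr_gt0 // ler_pdivrMr //.
move: (ue 0) (ue 1) vN; rewrite /sqnorm !mxE.
move: (v 0 0) (v 0 1) (u 0 0) (u 0 1) => a b c d.
rewrite !ler_norml => /andP[c1 c2] /andP[d1 d2] abN.
have e0 : 0 <= e by lra.
have aN : - N <= a <= N by apply/andP; split; nra.
have bN : - N <= b <= N by apply/andP; split; nra.
move: aN bN => /andP[a1 a2] /andP[b1 b2].
have ac1 : a * c <= e * N by nra.
have ac2 : - (e * N) <= a * c by nra.
have bd1 : b * d <= e * N by nra.
have bd2 : - (e * N) <= b * d by nra.
have c3 : c ^+ 2 <= e * N by nra.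
have d3 : d ^+ 2 <= e * N by nra.
have := sqr_ge0 c; have := sqr_ge0 d.
by move=> ? ?; apply/andP; split; lra.
Qed.

Lemma cross_perturb {R : realType} (v v' u u' : 'rV[R]_2) (e N : R) :
  sqnorm v = N -> sqnorm v' = N -> 1 <= N -> e <= 1 ->
  (forall i, `|u 0 i| <= e) -> (forall i, `|u' 0 i| <= e) ->
  cross v v' - 6 * e * N <= cross (v + u) (v' + u').
Proof.
move=> vN vN' N1 e1 ue ue'.
have N0 : 0 < N by lra.
move: (ue 0) (ue 1) (ue' 0) (ue' 1) vN vN'; rewrite /sqnorm /cross !mxE.
move: (v 0 0) (v 0 1) (u 0 0) (u 0 1) => a b c d.
move: (v' 0 0) (v' 0 1) (u' 0 0) (u' 0 1) => a' b' c' d'.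
rewrite !ler_norml => /andP[c1 c2] /andP[d1 d2] /andP[c1' c2'] /andP[d1' d2'].
move=> abN abN'.
have e0 : 0 <= e by lra.
have bnd x y : x ^+ 2 <= N -> - e <= y <= e -> - (e * N) <= x * y <= e * N.
  move=> xN /andP[y1 y2].
  have x1 : - N <= x by nra.
  have x2 : x <= N by nra.
  by apply/andP; split; nra.
have bnd' x y : - e <= x <= e -> - e <= y <= e -> - (e * N) <= x * y <= e * N.
  move=> /andP[x1 x2] /andP[y1 y2].
  have ee : e ^+ 2 <= e * N by nra.
  by apply/andP; split; nra.
have cb : - e <= c <= e by apply/andP; lra.
have db : - e <= d <= e by apply/andP; lra.
have cb' : - e <= c' <= e by apply/andP; lra.
have db' : - e <= d' <= e by apply/andP; lra.
have aa : a ^+ 2 <= N by nra.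
have bb : b ^+ 2 <= N by nra.
have aa' : a' ^+ 2 <= N by nra.
have bb' : b' ^+ 2 <= N by nra.
have := bnd _ _ aa db'; have := bnd _ _ bb cb'.
have := bnd _ _ aa' db; have := bnd _ _ bb' cb.
have := bnd' _ _ cb db'; have := bnd' _ _ db cb'.
lra.
Qed.

(** The homogeneous form of the inequality, for the triangle with vertices 0,
v + u, v' + u' near the equilateral triangle 0, v, v'.  The cross product is
twice the signed area, and 6 e = (b0 - 1) / 200 is the distortion allowed
by the normalized inequality. *)
Lemma triangle_inequality {R : realType} (b0 b e N : R) (v v' u u' : 'rV[R]_2) :
  1 < b0 -> b0 <= 2 -> b0 <= b -> e = (b0 - 1) / 1200 -> 1 <= N ->
  sqnorm v = N -> sqnorm v' = N -> sqnorm (v' - v) = N ->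
  cross v v' = Num.sqrt 3 / 2 * N ->
  (forall i, `|u 0 i| <= e) -> (forall i, `|u' 0 i| <= e) ->
  (forall i, `|(u' - u) 0 i| <= e) ->
  3 * N `^ (- b) - 3 * b * N `^ (- b) / (Num.sqrt 3 / 2 * N) *
      (cross (v + u) (v' + u') - cross v v')
  <= sqnorm (v + u) `^ (- b) + sqnorm (v' - v + (u' - u)) `^ (- b)
     + sqnorm (v' + u') `^ (- b).
Proof.
move=> b01 b02 b0b eE N1 vN vN' vN3 crN ue ue' ue3.
have N0 : 0 < N by lra.
have N00 := lt0r_neq0 N0.
have w0 := @sqrt3_gt0 R.
have w2 := @sqrt3_sqr R.
have w1 : 3 / 2 <= Num.sqrt 3 :> R by nra.
have K0 : 0 < Num.sqrt 3 / 2 * N by apply: mulr_gt0 => //; lra.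
have e1 : e <= 1 by lra.
have powN (a : R) : 0 <= a -> a `^ (- b) = N `^ (- b) * (1 + (a / N - 1)) `^ (- b).
  move=> a0; rewrite addrC subrK -powRM ?(ltW N0) //.
    by rewrite mulrC divfK.
  by apply: divr_ge0 => //; exact: ltW.
have t1 := sqnorm_perturb v u e N vN N1 e1 ue.
have t2 := sqnorm_perturb v' u' e N vN' N1 e1 ue'.
have t3 := sqnorm_perturb (v' - v) (u' - u) e N vN3 N1 e1 ue3.
have crp := cross_perturb v v' u u' e N vN vN' N1 e1 ue ue'.
set al := cross (v + u) (v' + u') / (Num.sqrt 3 / 2 * N).
have al0 : 0 < al.
  apply: divr_gt0 => //; apply: lt_le_trans crp.
  rewrite crN subr_gt0 ltr_pM2r //; lra.
have e6 : 6 * e = (b0 - 1) / 200 by rewrite eE; field.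
rewrite e6 in t1 t2 t3.
have key := triangle_inequality_normalized b0 b al _ _ _ b01 b02 b0b t1 t3 t2 al0.
rewrite (powN _ (sqnorm_ge0 (v + u))) (powN _ (sqnorm_ge0 (v' + u'))).
rewrite (powN _ (sqnorm_ge0 (v' - v + (u' - u)))) -!mulrDr.
have -> : 3 * N `^ (- b) - 3 * b * N `^ (- b) / (Num.sqrt 3 / 2 * N) *
      (cross (v + u) (v' + u') - cross v v') =
    N `^ (- b) * (3 - 3 * b * (al - 1)).
  rewrite crN /al; field.
  by rewrite N00 lt0r_neq0.
apply: ler_wpM2l; first exact: powR_ge0.
apply: key.
(* Heron's formula *)
have alE : 3 * al ^+ 2 =
    4 * cross (v + u) (v' + u') ^+ 2 / N ^+ 2.
  rewrite /al exprMn exprVn exprMn exprMn w2.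
  by field.
rewrite alE.
have h : v' - v + (u' - u) = (v' + u') - (v + u) by rewrite opprD addrACA.
rewrite h.
have -> : 4 * cross (v + u) (v' + u') ^+ 2 =
   (sqnorm (v + u) + sqnorm (v' + u') + sqnorm ((v' + u') - (v + u))) ^+ 2
   - 2 * (sqnorm (v + u) ^+ 2 + sqnorm (v' + u') ^+ 2
          + sqnorm ((v' + u') - (v + u)) ^+ 2).
  rewrite /cross /sqnorm !mxE; ring.
by field.
Qed.

(** * Counting lattice points near a circle *)

Lemma finite_box (P : nat) :
  finite_set [set z : int * int | (`|z.1| <= P)%N /\ (`|z.2| <= P)%N].
Proof.
pose f (i : nat * nat) : int * int := (i.1%:Z - P%:Z, i.2%:Z - P%:Z).
apply: (@sub_finite_set _ _ (f @` (`I_(2 * P).+1 `*` `I_(2 * P).+1))).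
  move=> [m n] [/= m1 n1]; exists (absz (m + P%:Z), absz (n + P%:Z)) => /=.
    by split => /=; lia.
  by rewrite /f /=; congr pair; lia.
by apply: finite_image; apply: finite_setX; exact: finite_II.
Qed.

Lemma sqnorm_hexpt_box {R : realType} (z : int * int) (M : R) (P : nat) :
  sqnorm (hexpt z) <= M -> 4 / 3 * M <= P%:R ^+ 2 ->
  (`|z.1| <= P)%N /\ (`|z.2| <= P)%N.
Proof.
rewrite sqnorm_hexpt => zM MP.
have [r1 _] := @r_star_bounds R.
have q0 : (0 : int) <= z.1 ^+ 2 + z.1 * z.2 + z.2 ^+ 2 by nia.
have : ((z.1 ^+ 2 + z.1 * z.2 + z.2 ^+ 2)%:~R : R) <= M.
  apply: le_trans zM; rewrite -{1}[_%:~R]mul1r ler_wpM2r //.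
  by rewrite ler0z.
move=> qM.
have : (((z.1 ^+ 2 + z.1 * z.2 + z.2 ^+ 2) *+ 4)%:~R : R) <= (P%:Z ^+ 2 *+ 3)%:~R.
  rewrite !rmorphMn /= rmorphXn /= -pmulrn -[X in X <= _]mulr_natr -[X in _ <= X]mulr_natr.
  lra.
rewrite ler_int => h.
have le1 : z.1 ^+ 2 <= P%:Z ^+ 2 by have := sqr_ge0 (z.1 + z.2 *+ 2); lia.
have le2 : z.2 ^+ 2 <= P%:Z ^+ 2 by have := sqr_ge0 (z.1 *+ 2 + z.2); lia.
by split; nia.
Qed.

Lemma finite_sqnorm_hexpt {R : realType} (M : R) :
  finite_set [set z | sqnorm (hexpt z) <= M].
Proof.
set P := (Num.truncn (4 / 3 * `|M|)).+1.
apply: sub_finite_set (finite_box P) => z /= zM.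
apply: sqnorm_hexpt_box zM _.
have h : 4 / 3 * `|M| <= P%:R by apply/ltW/truncnS_gt.
have P1 : (1 : R) <= P%:R by rewrite ler1n.
have := ler_norm M; nra.
Qed.

(** Twice the norm form at m minus twice that at m' is (m - m') (a + a') with
a = 2 m + n and a' = 2 m' + n of the same sign, and 2 (m - m') = a - a'. *)
Lemma same_sign_sqr_diff (m m' n L : int) :
  (0 <= m *+ 2 + n) = (0 <= m' *+ 2 + n) ->
  `|(m ^+ 2 + m * n + n ^+ 2) - (m' ^+ 2 + m' * n + n ^+ 2)| <= L ^+ 2 ->
  (m - m') ^+ 2 <= L ^+ 2.
Proof.
move=> sg; rewrite ler_norml => /andP[h1 h2].
have [E1|E1] := leP m m'; move: sg; have [a0|a0] := leP 0 (m *+ 2 + n);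
  have [a0'|a0'] := leP 0 (m' *+ 2 + n) => // _.
- have := mulr_ge0 (_ : 0 <= m' - m) a0; rewrite subr_ge0 E1 => /(_ isT).
  lia.
- have := mulr_ge0 (_ : 0 <= m' - m) (_ : 0 <= - (m' *+ 2 + n)).
  rewrite subr_ge0 E1 oppr_ge0 ltW // => /(_ isT isT); lia.
- have := mulr_ge0 (_ : 0 <= m - m') a0'; rewrite subr_ge0 ltW // => /(_ isT).
  lia.
- have := mulr_ge0 (_ : 0 <= m - m') (_ : 0 <= - (m *+ 2 + n)).
  rewrite subr_ge0 ltW // oppr_ge0 ltW // => /(_ isT isT); lia.
Qed.

(** In each row, on each side of the row's midpoint, the points of the annulus
form a run of at most L + 1 consecutive points.  They are therefore told
apart by their row, their side and their position modulo L + 1. *)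
Lemma card_annulus {R : realType} (B : {fset int * int}) (A W : R) (P L : nat) :
  (forall z, z \in B -> A <= sqnorm (hexpt z) <= A + W) ->
  (forall z, z \in B -> (`|z.2| <= P)%N) ->
  W <= L%:R ^+ 2 ->
  (#|` B | <= 2 * (2 * P).+1 * L.+1)%N.
Proof.
move=> BA BP WL.
pose f (z : int * int) : bool * 'I_(2 * P).+1 * 'I_L.+1 :=
  ((0 <= z.1 *+ 2 + z.2), inord (absz (z.2 + P%:Z)), inord (absz (z.1 %% L.+1%:Z)%Z)).
have finj : {in B &, injective f}.
  move=> [m n] [m' n'] zB zB' [].
  have := BP _ zB; have := BP _ zB' => /= nP' nP.
  move=> sg /(congr1 val) /=; rewrite !inordK ?ltnS; [|lia..].
  move=> en.
  have {en nP nP'} en : n = n' by lia.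
  subst n' => /(congr1 val) /=.
  have md (x : int) : (`|(x %% L.+1%:Z)%Z| < L.+1)%N by lia.
  rewrite !inordK //.
  have dl : ((m - m') ^+ 2 <= L%:Z ^+ 2)%R.
    have := BA _ zB; have := BA _ zB'; rewrite !sqnorm_hexpt /=.
    have [r1 _] := @r_star_bounds R.
    move=> /andP[a1 a2] /andP[a3 a4].
    have h : `|(m ^+ 2 + m * n + n ^+ 2)%:~R -
               (m' ^+ 2 + m' * n + n ^+ 2)%:~R| <= W.
      move: (_%:~R) (_%:~R) a1 a2 a3 a4 => q' q a1 a2 a3 a4.
      have : r_star R ^+ 2 * `|q' - q| <= W.
        rewrite -{1}(ger0_norm (x := r_star R ^+ 2)); last by lra.
        by rewrite -normrM ler_norml mulrBr; apply/andP; split; lra.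
      by have := normr_ge0 (q' - q); nra.
    have := le_trans h WL.
    rewrite -intrB -intr_norm -[L%:R]/(L%:Z%:~R) -rmorphXn /= ler_int.
    exact: same_sign_sqr_diff.
  have {}dl : (absz (m - m')%R <= L)%N by nia.
  move=> em; congr pair.
  have {}em : (m %% L.+1%:Z)%Z = (m' %% L.+1%:Z)%Z.
    by move: (modz_ge0 m (isT : L.+1%:Z != 0)) (modz_ge0 m' (isT : L.+1%:Z != 0)); lia.
  have := divz_eq m L.+1%:Z; have := divz_eq m' L.+1%:Z.
  rewrite em; move: (m %/ _)%Z (m' %/ _)%Z (m' %% _)%Z => a b c.
  move=> mE' mE; case: (ltgtP a b) => ab.
  - have : 0 <= (b - a - 1) * L.+1%:Z by apply: mulr_ge0; lia.
    lia.
  - have : 0 <= (a - b - 1) * L.+1%:Z by apply: mulr_ge0; lia.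
    lia.
  - by rewrite mE mE' ab.
have u : uniq (map f B) by rewrite map_inj_in_uniq ?fset_uniq.
rewrite -(size_map f) -(card_uniqP u).
apply: leq_trans (max_card _) _. by rewrite !card_prod !card_ord card_bool.
Qed.

(** Only the points that leave D under the translation by w are kept. *)
Definition boundary (D : {fset int * int}) (w : int * int) : {fset int * int} :=
  [fset z in D | (z + w)%R \notin D]%fset.

Definition near_lattice {R : realType} (Y : int * int -> 'rV[R]_2) :=
  forall z i, `|Y z 0 i - hexpt z 0 i| <= 1.

Definition indices_in_disk {R : realType} (Y : int * int -> 'rV[R]_2) (r : R) :
  {fset int * int} := fset_set [set z | sqnorm (Y z) <= r ^+ 2].

Lemma finite_indices {R : realType} (Y : int * int -> 'rV[R]_2) (r : R) :
  near_lattice Y -> finite_set [set z | sqnorm (Y z) <= r ^+ 2].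
Proof.
move=> nY; apply: (sub_finite_set _ (finite_sqnorm_hexpt (2 * r ^+ 2 + 4))).
move=> z /=; move: (nY z 0) (nY z 1); rewrite /sqnorm.
move: (Y z 0 0) (Y z 0 1) (hexpt z 0 0) (hexpt z 0 1) => a b c d.
move=> ac bd h.
have ac2 : (a - c) ^+ 2 <= 1 by rewrite -real_normK ?num_real // expr_le1.
have bd2 : (b - d) ^+ 2 <= 1 by rewrite -real_normK ?num_real // expr_le1.
have := sqr_ge0 (2 * a - c); have := sqr_ge0 (2 * b - d); lra.
Qed.

Lemma in_indices {R : realType} (Y : int * int -> 'rV[R]_2) (r : R) z :
  near_lattice Y -> (z \in indices_in_disk Y r) = (sqnorm (Y z) <= r ^+ 2).
Proof.
move=> nY; rewrite in_fset_set; last exact: finite_indices.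
by apply/idP/idP; rewrite inE.
Qed.

(** The points with both coordinates between 0 and (r - 2) / 2. *)
Lemma card_indices_ge {R : realType} (Y : int * int -> 'rV[R]_2) (r : R) :
  near_lattice Y -> 4 <= r ->
  r ^+ 2 / 16 <= #|` indices_in_disk Y r|%:R.
Proof.
move=> nY r4.
have r20 : 0 <= (r - 2) / 2 by lra.
set j := Num.truncn ((r - 2) / 2).
have j1 : j%:R <= (r - 2) / 2 by rewrite truncn_le.
have j2 : (r - 2) / 2 < j.+1%:R by exact: truncnS_gt.
pose f (i : 'I_j.+1 * 'I_j.+1) : int * int := (i.1%:Z, i.2%:Z).
have finj : injective f.
  by move=> [a b] [c d] [/val_inj -> /val_inj ->].
have fD z : z \in map f (enum {: 'I_j.+1 * 'I_j.+1}) -> z \in indices_in_disk Y r.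
  move=> /mapP[[a b] _ ->]; rewrite in_indices //.
  have aj : (a%:Z%:~R : R) <= j%:R by rewrite -pmulrn ler_nat -ltnS.
  have bj : (b%:Z%:~R : R) <= j%:R by rewrite -pmulrn ler_nat -ltnS.
  have a0 : (0 : R) <= a%:Z%:~R by rewrite -pmulrn.
  have b0 : (0 : R) <= b%:Z%:~R by rewrite -pmulrn.
  move: (nY (f (a, b)) 0) (nY (f (a, b)) 1).
  have : sqnorm (hexpt (f (a, b))) <= (2 * j%:R : R) ^+ 2.
    rewrite sqnorm_hexpt /f /= !intrD intrM !rmorphXn /=.
    move: (a%:~R) (b%:~R) aj bj a0 b0 => x y x1 y1 x0 y0.
    have q1 : x ^+ 2 + x * y + y ^+ 2 <= 3 * j%:R ^+ 2 by nra.
    have q0 : 0 <= x ^+ 2 + x * y + y ^+ 2 by nra.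
    have [r1 r2] := @r_star_bounds R.
    by nra.
  have j0 : (0 : R) <= j%:R by [].
  have jr : 2 * j%:R + 2 <= r by lra.
  rewrite /sqnorm; move: (j%:R) j0 jr => J J0 Jr.
  move: (Y _ 0 0) (Y _ 0 1) (hexpt _ 0 0) (hexpt _ 0 1) => y0 y1 h0 h1.
  rewrite !ler_norml => h /andP[c1 c2] /andP[d1 d2].
  have hh : (2 * J + 2) ^+ 2 <= r ^+ 2 by rewrite ler_pXn2r // nnegrE; lra.
  apply: le_trans hh.
  have g1 : h0 <= 2 * J by nra.
  have g2 : - (2 * J) <= h0 by nra.
  have g3 : h1 <= 2 * J by nra.
  have g4 : - (2 * J) <= h1 by nra.
  have k1 : y0 ^+ 2 <= h0 ^+ 2 + 4 * J + 1 by nra.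
  have k2 : y1 ^+ 2 <= h1 ^+ 2 + 4 * J + 1 by nra.
  by lra.
have := uniq_leq_size (_ : uniq (map f (enum {: 'I_j.+1 * 'I_j.+1}))) fD.
rewrite map_inj_uniq // enum_uniq size_map -cardE card_prod !card_ord.
move=> /(_ isT); rewrite -(ler_nat R) natrM => h; apply: le_trans h.
move: (j.+1%:R) j2 => J J2; nra.
Qed.

Lemma coord_le_radius {R : realType} (y0 y1 r : R) :
  0 <= r -> y0 ^+ 2 + y1 ^+ 2 <= r ^+ 2 -> `|y0| <= r /\ `|y1| <= r.
Proof.
move=> r0 h; have := sqr_ge0 y0; have := sqr_ge0 y1 => h1 h0.
by split; rewrite -(ler_pXn2r (n := 2)) ?nnegrE // real_normK ?num_real //; lra.
Qed.

(** One coordinate of the step from a point of the disk to a point outside: y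
and x are those of the perturbations of the lattice points, h and h + w. *)
Lemma coord_shift {R : realType} (y h x h' w k r : R) :
  `|y| <= r -> `|y - h| <= 1 -> `|x - h'| <= 1 -> h' = h + w -> `|w| + 2 <= k ->
  [/\ x ^+ 2 <= y ^+ 2 + 2 * r * k + k ^+ 2, h ^+ 2 <= y ^+ 2 + 2 * r + 1
    & y ^+ 2 - 2 * r - 1 <= h ^+ 2].
Proof.
move=> yr yh xh hE wk; rewrite {}hE in xh.
have xy : `|x - y| <= k.
  have -> : x - y = (x - (h + w)) + (w - (y - h)) by ring.
  apply: le_trans (ler_normD _ _) _; have := ler_normB w (y - h); lra.
have sq1 : (x - y) ^+ 2 <= k ^+ 2.
  by rewrite -(real_normK (num_real (x - y))) ler_pXn2r ?nnegrE //; have := normr_ge0 w; lra.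
have sq2 : (y - h) ^+ 2 <= 1 by rewrite -real_normK ?num_real // expr_le1.
have m1 : `|y * (x - y)| <= r * k by rewrite normrM ler_pM.
have m2 : `|y * (y - h)| <= r by rewrite normrM -[leRHS]mulr1 ler_pM.
move: m1 m2; rewrite !ler_norml => /andP[m1 m2] /andP[m3 m4].
have sq3 := sqr_ge0 (y - h).
by split; lra.
Qed.

(** A point of the disk that leaves it under the translation by w comes from a
lattice point whose squared length is within O(k r) of r^2. *)
Lemma card_boundary_le {R : realType} (Y : int * int -> 'rV[R]_2) (w : int * int)
    (k r : R) :
  near_lattice Y -> 9 <= k -> (forall i, `|hexpt w 0 i| + 2 <= k) -> k <= r ->
  #|` boundary (indices_in_disk Y r) w|%:R
   <= 60 * r * Num.sqrt (k * r).
Proof.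
move=> nY k9 wk kr.
set B := boundary _ _.
set q := Num.sqrt (k * r).
have q0 : 0 <= q by exact: sqrtr_ge0.
have qE : q ^+ 2 = k * r by rewrite sqr_sqrtr //; nra.
have q9 : 9 <= q by nra.
pose P := (Num.truncn (2 * r + 3)).+1.
pose L := (Num.truncn (4 * q)).+1.
have P1 : 2 * r + 3 <= P%:R by apply/ltW/truncnS_gt.
have P2 : P%:R <= 2 * r + 4 :> R.
  rewrite /P -addn1 natrD; have : (Num.truncn (2 * r + 3))%:R <= 2 * r + 3.
    by rewrite truncn_le; lra.
  by lra.
have L1 : 4 * q <= L%:R by apply/ltW/truncnS_gt.
have L2 : L%:R <= 4 * q + 1.
  rewrite /L -addn1 natrD; have : (Num.truncn (4 * q))%:R <= 4 * q.
    by rewrite truncn_le; lra.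
  by lra.
have annulus z : z \in B ->
    r ^+ 2 - 4 * r * k - 2 * k ^+ 2 - 4 * r - 2 <= sqnorm (hexpt z)
      <= r ^+ 2 - 4 * r * k - 2 * k ^+ 2 - 4 * r - 2 + 16 * k * r /\
    sqnorm (hexpt z) <= r ^+ 2 + 4 * r + 2.
  rewrite !inE /= => /andP[]; rewrite !in_indices // -ltNge => zr zwr.
  have r0 : 0 <= r by lra.
  have [y0r y1r] := coord_le_radius _ _ _ r0 zr.
  have [d0 e0 f0] := coord_shift _ _ _ _ _ _ _ y0r (nY z 0) (nY (z + w) 0)
    (hexpt_coordD z w 0) (wk 0).
  have [d1 e1 f1] := coord_shift _ _ _ _ _ _ _ y1r (nY z 1) (nY (z + w) 1)
    (hexpt_coordD z w 1) (wk 1).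
  rewrite /sqnorm in zr zwr *.
  have kk : k ^+ 2 <= k * r by rewrite expr2 ler_pM2l; lra.
  have kr9 : 9 * r <= k * r by rewrite ler_wpM2r.
  by split; [apply/andP; split; lra|lra].
have cB : (#|` B| <= 2 * (2 * P).+1 * L.+1)%N.
  apply: card_annulus.
  - by move=> z /annulus[h _]; exact: h.
  - move=> z /annulus[_ h]; apply: (proj2 (sqnorm_hexpt_box z _ P h _)).
    by nra.
  - by rewrite -mulrA -qE; nra.
rewrite -(ler_nat R) in cB; apply: le_trans cB _.
have -> : (2 * (2 * P).+1 * L.+1)%N%:R = 2 * (2 * P%:R + 1) * (L%:R + 1) :> R.
  by rewrite natrM natrM -[(2 * P).+1%:R]natr1 -[L.+1%:R]natr1 natrM.
have -> : 60 * r * q = 2 * (5 * r) * (6 * q) by ring.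
apply: ler_pM; [nra|nra| |lra].
by lra.
Qed.

Lemma boundary_negligible {R : realType} (Y : int * int -> 'rV[R]_2)
    (w : int * int) :
  near_lattice Y ->
  #|` boundary (indices_in_disk Y r) w|%:R
    / #|` indices_in_disk Y r|%:R @[r --> +oo] --> (0 : R).
Proof.
move=> nY; apply/cvgr0Pnorm_le => eta eta0.
set k := `|hexpt w 0 0| + `|hexpt w 0 1| + 9 : R.
have h0 := normr_ge0 (hexpt w 0 0 : R); have h1 := normr_ge0 (hexpt w 0 1 : R).
have k9 : 9 <= k by rewrite /k; lra.
have wk i : `|hexpt w 0 i| + 2 <= k.
  have [->|->] := ord2_cases i.
  - by rewrite /k; lra.
  - by rewrite /k; lra.
(* the quotient of the constants of the two counting bounds *)
have [C C0 CE] : exists2 C : R, 0 < C & C = 60 * 16.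
  by exists (60 * 16); [lra|reflexivity].
near=> r.
have kr : k <= r by near: r; apply: nbhs_pinfty_ge; rewrite num_real.
have r4 : 4 <= r by lra.
have D0 := card_indices_ge Y r nY r4.
have Dp : (0 : R) < #|` indices_in_disk Y r|%:R by apply: lt_le_trans D0; nra.
rewrite ger0_norm ?divr_ge0 // ler_pdivrMr //.
apply: le_trans (card_boundary_le Y w k r nY k9 wk kr) _.
have : eta * (r ^+ 2 / 16) <= eta * #|` indices_in_disk Y r|%:R.
  by rewrite ler_pM2l.
apply: le_trans.
have large : C ^+ 2 * k / eta ^+ 2 <= r.
  by near: r; apply: nbhs_pinfty_ge; rewrite num_real.
have r0 : 0 <= r by lra.
have k0 : 0 <= k by lra.
have rhs0 : 0 <= eta * r / C by rewrite divr_ge0 ?mulr_ge0 // ltW.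
have sq : Num.sqrt (k * r) <= eta * r / C.
  rewrite -(ler_pXn2r (n := 2)) ?nnegrE ?sqrtr_ge0 // sqr_sqrtr ?mulr_ge0 //.
  move: large; rewrite ler_pdivrMr ?exprn_gt0 // => large.
  have -> : (eta * r / C) ^+ 2 = r * eta ^+ 2 * (r / C ^+ 2).
    by field; rewrite gt_eqF.
  have -> : k * r = C ^+ 2 * k * (r / C ^+ 2) by field; rewrite gt_eqF.
  by apply: ler_wpM2r => //; rewrite divr_ge0 ?exprn_ge0 // ltW.
have -> : eta * (r ^+ 2 / 16) = 60 * r * (eta * r / C).
  by rewrite CE; field.
by apply: ler_wpM2l => //; lra.
Unshelve. all: by end_near.
Qed.

(** * Averages over Foelner families *)

Lemma ler_sum_uniq_subset {R : realType} {I : eqType} (s t : seq I) (g : I -> R) :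
  uniq s -> uniq t -> {subset s <= t} -> (forall i, 0 <= g i) ->
  \sum_(i <- s) g i <= \sum_(i <- t) g i.
Proof.
move=> us ut st g0; rewrite [leRHS](bigID (fun i => i \in s)) /=.
have <- : \sum_(i <- s) g i = \sum_(i <- t | i \in s) g i.
  rewrite -[RHS]big_filter; apply: perm_big; apply: uniq_perm => //.
    exact: filter_uniq.
  by move=> i; rewrite mem_filter andb_idr //; exact: st.
by rewrite lerDl sumr_ge0.
Qed.

Definition mean {R : realType} (D : {fset int * int}) (phi : int * int -> R) : R :=
  (\sum_(x <- D) phi x) / #|` D|%:R.

(** Foelner's condition, for the translations of the lattice. *)
Definition folner {R : realType} (D : R -> {fset int * int}) :=
  forall w, #|` boundary (D r) w|%:R / #|` D r|%:R @[r --> +oo] --> (0 : R).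

Lemma sum_boundary_le {R : realType} (D : {fset int * int}) (w : int * int)
    (phi : int * int -> R) (B : R) :
  (forall z, `|phi z| <= B) ->
  `|\sum_(x <- D | x + w \notin D) phi x| <= B * #|` boundary D w|%:R.
Proof.
move=> phiB; rewrite big_fset_condE -/(boundary D w).
rewrite card_fset_sum1 natr_sum mulr_sumr.
apply: le_trans (ler_norm_sum _ _ _) _.
by apply: ler_sum => z _; rewrite mulr1; exact: phiB.
Qed.

Lemma sum_shift {R : realType} (D : {fset int * int}) (w : int * int)
    (phi : int * int -> R) :
  \sum_(x <- D | x + w \in D) phi (x + w) = \sum_(y <- D | y - w \in D) phi y.
Proof.
rewrite -big_filter -[RHS]big_filter.
rewrite -(big_map (fun x => x + w) xpredT phi).
apply: perm_big; apply: uniq_perm.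
- by rewrite map_inj_uniq ?filter_uniq ?fset_uniq //; exact: addIr.
- by rewrite filter_uniq ?fset_uniq.
- move=> y; rewrite mem_filter; apply/mapP/andP.
    by move=> [x]; rewrite mem_filter => /andP[xw xD] ->; rewrite addrK.
  move=> [ywD yD]; exists (y - w); last by rewrite subrK.
  by rewrite mem_filter subrK yD.
Qed.

(** The two sums over D r cancel except over the points that enter or leave
D r under the translation by w. *)
Lemma mean_coboundary {R : realType} (D : R -> {fset int * int}) (w : int * int)
    (phi : int * int -> R) (B : R) :
  folner D -> (forall z, `|phi z| <= B) ->
  mean (D r) (fun x => phi (x + w) - phi x) @[r --> +oo] --> (0 : R).
Proof.
move=> folD phiB; apply: norm_cvg0.
pose b v (r : R) : R := #|` boundary (D r) v|%:R / #|` D r|%:R.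
have bnd r : 0 <= `|mean (D r) (fun x => phi (x + w) - phi x)|
             <= B * b w r + B * b (- w) r.
  rewrite normr_ge0 /= /mean /b !mulrA -mulrDl normrM.
  rewrite [X in _ * X]ger0_norm ?invr_ge0 //.
  apply: ler_wpM2r; first by rewrite invr_ge0.
  rewrite big_split /= sumrN.
  rewrite (bigID (fun x => x + w \in D r)) /= sum_shift.
  rewrite [X in _ - X](bigID (fun x => x - w \in D r)) /=.
  set a := \sum_(i <- D r | i - w \in D r) phi i.
  set c := \sum_(i <- D r | i + w \notin D r) phi (i + w).
  set d := \sum_(i <- D r | i - w \notin D r) phi i.
  have -> : a + c - (a + d) = c - d by ring.
  apply: le_trans (ler_normB _ _) _; apply: lerD; last exact: sum_boundary_le.
  exact: (@sum_boundary_le _ _ _ (fun z => phi (z + w))).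
apply: (squeeze_cvgr (f := fun=> 0)
  (h := fun r => B * b w r + B * b (- w) r)).
- by near=> r; exact: bnd.
- exact: cvg_cst.
- rewrite -[X in _ --> X](_ : B * 0 + B * 0 = 0); last by ring.
  by apply: cvgD; apply: cvgMr => //; exact: folD.
Unshelve. all: by end_near.
Qed.

Lemma mean_sum_coboundaries {R : realType} (D : R -> {fset int * int})
    (V : seq (int * int)) (c : int * int -> R)
    (phi : int * int -> int * int -> R) (w : int * int -> int * int)
    (B : int * int -> R) :
  folner D -> (forall v z, v \in V -> `|phi v z| <= B v) ->
  mean (D r) (fun x => \sum_(v <- V) c v * (phi v (x + w v) - phi v x))
    @[r --> +oo] --> (0 : R).
Proof.
move=> folD; elim: V => [|v V IH] phiB.
  rewrite (_ : (fun r => _) = fun=> 0); first exact: cvg_cst.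
  apply/funext => r; rewrite /mean big1 ?mul0r // => x _.
  by rewrite big_nil.
rewrite (_ : (fun r => _) = fun r =>
    c v * mean (D r) (fun x => phi v (x + w v) - phi v x) +
    mean (D r) (fun x => \sum_(v <- V) c v * (phi v (x + w v) - phi v x))).
  rewrite -[X in _ --> X](_ : c v * 0 + 0 = 0); last by ring.
  apply: cvgD.
    apply: cvgMr => //; apply: mean_coboundary folD _ => z.
    by apply: phiB; rewrite mem_head.
  by apply: IH => v' z v'V; apply: phiB; rewrite in_cons v'V orbT.
apply/funext => r; rewrite /mean mulrA mulr_sumr -mulrDl -big_split /=.
by congr (_ / _); apply: eq_bigr => x _; rewrite big_cons.
Qed.

Lemma energy_in_disk_range {R : realType} (f : R -> R)
    (Y : int * int -> 'rV[R]_2) (r : R) :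
  near_lattice Y -> injective Y -> 0 <= r ->
  energy_in_disk f (range Y) r =
  mean (indices_in_disk Y r) (fun x =>
    \sum_(y <- (indices_in_disk Y r `\ x)%fset) f (eucl_norm (Y x - Y y))).
Proof.
move=> nY injY r0.
set A := [set z | sqnorm (Y z) <= r ^+ 2].
have finA : finite_set A := finite_indices Y r nY.
have XA : range Y `&` disk r = Y @` A.
  apply/seteqP; split => [_ [[z _ <-] /(disk_sqnorm _ _ r0) zr]|_ [z zA <-]].
    by exists z.
  by split; [exists z|apply/(disk_sqnorm _ _ r0)].
rewrite /energy_in_disk XA /mean; congr (_ / _).
  rewrite fsbig_image; last by move=> ? ? _ _; exact: injY.
  rewrite (fsbig_finite _ _ finA); apply: eq_bigr => x _.
  have -> : (Y @` A) `\ Y x = Y @` (A `\ x).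
    apply/seteqP; split => [_ [[z zA <-] zx]|_ [z [zA zx] <-]].
      by exists z => //; split => // zx'; apply: zx; rewrite zx'.
    by split; [exists z|move=> /injY].
  rewrite fsbig_image; last by move=> ? ? _ _; exact: injY.
  rewrite fsbig_finite ?fset_setD1 //.
  exact: finite_setD.
by rewrite fset_set_image // card_imfset.
Qed.

(** The pairs whose difference is not in V are discarded, which is harmless as
g is nonnegative; the second sum pays for the pairs x, x + v with x + v
outside D that the mean on the left counts. *)
Lemma energy_lower_bound {R : realType} (g : 'rV[R]_2 -> R)
    (Y : int * int -> 'rV[R]_2) (D : {fset int * int}) (V : {fset int * int})
    (B : R) :
  0 \notin V -> (forall x, 0 <= g x) -> (forall x, g (- x) = g x) ->
  (forall x v, v \in V -> g (Y (x + v) - Y x) <= B) ->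
  mean D (fun x => \sum_(v <- V) g (Y (x + v) - Y x))
    - \sum_(v <- V) B * (#|` boundary D v|%:R / #|` D|%:R)
  <= mean D (fun x => \sum_(y <- (D `\ x)%fset) g (Y x - Y y)).
Proof.
move=> V0 g0 gN gB.
under eq_bigr do rewrite mulrA.
rewrite /mean -mulr_suml -mulrBl.
apply: ler_wpM2r; first by rewrite invr_ge0.
have -> : \sum_(v <- V) B * #|` boundary D v|%:R =
    \sum_(x <- D) \sum_(v <- V | x + v \notin D) B.
  rewrite (exchange_big_dep xpredT) //=; apply: eq_bigr => v _.
  by rewrite big_fset_condE -/(boundary D v) card_fset_sum1 natr_sum mulr_sumr;
    apply: eq_bigr => x _; rewrite mulr1.
rewrite -sumrB big_seq [leRHS]big_seq; apply: ler_sum => x xD.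
rewrite lerBlDr (bigID (fun v => x + v \in D)) /=.
apply: lerD; last first.
  by rewrite big_seq_cond [leRHS]big_seq_cond; apply: ler_sum => v /andP[vV _]; exact: gB.
rewrite -big_filter.
have -> : \sum_(v <- [seq v <- V | x + v \in D]) g (Y (x + v) - Y x) =
    \sum_(y <- [seq x + v | v <- [seq v <- V | x + v \in D]]) g (Y x - Y y).
  by rewrite big_map; apply: eq_bigr => v _; rewrite -gN opprB.
apply: ler_sum_uniq_subset => //.
- by rewrite map_inj_uniq ?filter_uniq ?fset_uniq //; exact: addrI.
- exact: fset_uniq.
- move=> y /mapP[v]; rewrite mem_filter => /andP[xvD vV] ->.
  rewrite !inE xvD andbT; apply: contra V0 => /eqP xv.
  suff -> : 0 = v by [].
  by apply: (addrI x); rewrite addr0 xv.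
Qed.

(** * Telescoping over the triangles of the lattice *)

(** The interactions of bounded range: a finite set of lattice vectors stable
under the rotation by 60 degrees. *)
Definition short_vectors {R : realType} (M : R) : {fset int * int} :=
  fset_set [set z | z != 0 /\ sqnorm (hexpt z) <= M].

Lemma in_short_vectors {R : realType} (M : R) z :
  (z \in short_vectors M) = (z != 0) && (sqnorm (hexpt z) <= M).
Proof.
rewrite in_fset_set; first by apply/idP/idP; rewrite inE => /andP.
by apply: (sub_finite_set _ (finite_sqnorm_hexpt M)) => x [].
Qed.

Lemma rot6_inj : injective rot6.
Proof.
move=> [a b] [c d] [] /= h1 h2; have bd : b = d by apply: oppr_inj.
by move: h2; rewrite bd => /addIr ->.
Qed.

Lemma rot6_eq0 z : (rot6 z == 0) = (z == 0).
Proof. by apply/eqP/eqP => [h|->] //; apply: rot6_inj. Qed.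

Lemma sum_short_vectors_rot6 {R : realType} (M : R) (G : int * int -> R) :
  \sum_(v <- short_vectors M) G (rot6 v) = \sum_(v <- short_vectors M) G v.
Proof.
rewrite -(big_map rot6 xpredT G); apply: perm_big.
have u : uniq (map rot6 (short_vectors M)).
  by rewrite map_inj_uniq ?fset_uniq //; exact: rot6_inj.
apply: uniq_perm => //; first exact: fset_uniq.
have sub : {subset map rot6 (short_vectors M) <= short_vectors M}.
  move=> _ /mapP[z zM ->]; move: zM.
  by rewrite !in_short_vectors rot6_eq0 sqnorm_rot6.
by case: (uniq_min_size u sub _) => //; rewrite size_map.
Qed.

(** Minus the identity is the third power of the rotation. *)
Lemma sum_short_vectors_opp {R : realType} (M : R) (G : int * int -> R) :
  \sum_(v <- short_vectors M) G (- v) = \sum_(v <- short_vectors M) G v.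
Proof.
rewrite -[RHS]sum_short_vectors_rot6 -[RHS]sum_short_vectors_rot6 -[RHS]sum_short_vectors_rot6.
apply: eq_bigr => v _; congr G.
by case: v => a b; rewrite /rot6 /=; congr pair; rewrite /=; ring.
Qed.

Lemma crossC {R : realType} (x y : 'rV[R]_2) : cross x y = - cross y x.
Proof. by rewrite /cross; ring. Qed.

Lemma rot6_triangle (x z : int * int) : x + z + rot6 (rot6 z) = x + rot6 z.
Proof. by rewrite rot6_rot6 addrAC addrA subrK. Qed.

Lemma cross_increment {R : realType} (h h' d0 d1 d2 : 'rV[R]_2) :
  cross (h + (d1 - d0)) (h' + (d2 - d0)) - cross h h' =
  (cross h d2 - cross h d0) + (cross d1 h' - cross d0 h')
  + (cross d1 d2 + cross d0 d1 - cross d0 d2).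
Proof. by rewrite /cross !mxE; ring. Qed.

Lemma cross_bounded {R : realType} (x y : 'rV[R]_2) (a b : R) :
  (forall i, `|x 0 i| <= a) -> (forall i, `|y 0 i| <= b) ->
  `|cross x y| <= a * b + a * b.
Proof.
move=> xa yb; rewrite /cross; apply: le_trans (ler_normB _ _) _.
by rewrite !normrM; apply: lerD; apply: ler_pM.
Qed.

Lemma coord_bounded {R : realType} (x : 'rV[R]_2) i :
  `|x 0 i| <= `|x 0 0| + `|x 0 1|.
Proof.
have [->|->] := ord2_cases i.
- by rewrite lerDl.
- by rewrite lerDr.
Qed.

Definition mean_null {R : realType} (D : R -> {fset int * int})
  (phi : int * int -> R) := mean (D r) phi @[r --> +oo] --> (0 : R).

Lemma mean_nullD {R : realType} (D : R -> {fset int * int})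
    (phi psi : int * int -> R) :
  mean_null D phi -> mean_null D psi -> mean_null D (fun x => phi x + psi x).
Proof.
move=> phi0 psi0; rewrite /mean_null.
rewrite (_ : (fun r => _) = (fun r => mean (D r) phi + mean (D r) psi)).
  by rewrite -[X in _ --> X](addr0 0); apply: cvgD.
by apply/funext => r; rewrite /mean big_split mulrDl.
Qed.

(** Each of the three families of sides of the triangles x, x + v, x + omega v,
with x and v varying, runs once through all the ordered pairs of points with
difference in short_vectors M. *)
Lemma mean_null_triangle_sides {R : realType} (D : R -> {fset int * int}) (M B : R)
    (F : int * int -> int * int -> R) :
  folner D -> (forall v x, v \in short_vectors M -> `|F v x| <= B) ->
  mean_null D (fun x =>
    \sum_(v <- short_vectors M)
       (F v x + F (rot6 (rot6 v)) (x + v) + F (- rot6 v) (x + rot6 v))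
    - 3 * \sum_(v <- short_vectors M) F v x).
Proof.
move=> folD FB.
have FBr v x : v \in short_vectors M -> `|F (rot6 (rot6 v)) x| <= B.
  by move=> vV; apply: FB; move: vV; rewrite !in_short_vectors !rot6_eq0 !sqnorm_rot6.
have FBn v x : v \in short_vectors M -> `|F (- rot6 v) x| <= B.
  move=> vV; apply: FB; move: vV.
  by rewrite !in_short_vectors oppr_eq0 rot6_eq0 hexptN sqnormN sqnorm_rot6.
have c1 := mean_sum_coboundaries D (short_vectors M) (fun=> 1)
  (fun v => F (rot6 (rot6 v))) id (fun=> B) folD FBr.
have c2 := mean_sum_coboundaries D (short_vectors M) (fun=> 1)
  (fun v => F (- rot6 v)) rot6 (fun=> B) folD FBn.
have := mean_nullD D _ _ c1 c2; congr mean_null; apply/funext => x.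
have S1 : \sum_(v <- short_vectors M) F (rot6 (rot6 v)) x = \sum_(v <- short_vectors M) F v x.
  rewrite (sum_short_vectors_rot6 M (fun v => F (rot6 v) x)).
  exact: (sum_short_vectors_rot6 M (fun v => F v x)).
have S2 : \sum_(v <- short_vectors M) F (- rot6 v) x = \sum_(v <- short_vectors M) F v x.
  rewrite (sum_short_vectors_rot6 M (fun v => F (- v) x)).
  exact: (sum_short_vectors_opp M (fun v => F v x)).
rewrite -!mulr_sumr !mul1r !sumrB !big_split /= S1 S2; ring.
Qed.

(** The area is a null Lagrangian.  With h = hexpt v, h' = hexpt (rot6 v) and
q v x = d x cross d (x + v), the increment of the cross product is the sum of
the differences of h cross d and of d cross h' under translations, and of
q (rot6 (rot6 v)) (x + v) + q v x - q (rot6 v) x.  By invariance of c under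
the rotation, the last two terms cancel when summed over v.  The first one is
equivalent to q v x, whose weighted sum is equivalent to its opposite because
q v x = - q (- v) (x + v). *)
Lemma mean_null_triangle_areas {R : realType} (D : R -> {fset int * int}) (M B : R)
    (d : int * int -> 'rV[R]_2) (c : int * int -> R) :
  let Y z := hexpt z + d z in
  folner D -> (forall z i, `|d z 0 i| <= B) ->
  (forall v, c (rot6 v) = c v) ->
  mean_null D (fun x => \sum_(v <- short_vectors M) c v *
    (cross (Y (x + v) - Y x) (Y (x + rot6 v) - Y x)
     - cross (hexpt v) (hexpt (rot6 v)))).
Proof.
move=> Y folD dB crot.
have copp v : c (- v) = c v.
  rewrite -[RHS]crot -[RHS]crot -[RHS]crot; congr c.
  by case: v => a b; rewrite /rot6 /=; congr pair; rewrite /=; ring.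
have YE x v : Y (x + v) - Y x = hexpt v + (d (x + v) - d x).
  exact: hexpt_perturbed_sub.
pose q (v x : int * int) := cross (d x) (d (x + v)).
pose h1 (v x : int * int) := cross (hexpt v) (d x).
pose h2 (v x : int * int) := cross (d x) (hexpt (rot6 v)).
have h1B v z : v \in short_vectors M -> `|h1 v z| <= _ :=
  fun vV => cross_bounded _ _ _ _ (coord_bounded (hexpt v)) (dB z).
have h2B v z : v \in short_vectors M -> `|h2 v z| <= _ :=
  fun vV => cross_bounded _ _ _ _ (dB z) (coord_bounded (hexpt (rot6 v))).
have qB (f : int * int -> int * int) v z : v \in short_vectors M -> `|q (f v) z| <= _ :=
  fun vV => cross_bounded _ _ _ _ (dB z) (dB _).
have c1 := mean_sum_coboundaries D (short_vectors M) c h1 rot6 _ folD h1B.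
have c2 := mean_sum_coboundaries D (short_vectors M) c h2 id _ folD h2B.
have c3 := mean_sum_coboundaries D (short_vectors M) c (fun v => q (rot6 (rot6 v))) id
  (fun=> _) folD (qB (fun v => rot6 (rot6 v))).
have c4 := mean_sum_coboundaries D (short_vectors M) (fun v => - (c v / 2))
  (fun v => q (- v)) id (fun=> _) folD (qB (fun v => - v)).
have := mean_nullD D _ _ (mean_nullD D _ _ c1 c2) (mean_nullD D _ _ c3 c4).
congr mean_null; apply/funext => x.
have E v : c v * (cross (Y (x + v) - Y x) (Y (x + rot6 v) - Y x)
      - cross (hexpt v) (hexpt (rot6 v))) =
    c v * (h1 v (x + rot6 v) - h1 v x) + c v * (h2 v (x + v) - h2 v x)
    + (c v * q (rot6 (rot6 v)) (x + v) + c v * q v x - c v * q (rot6 v) x).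
  rewrite !YE cross_increment /h1 /h2 /q rot6_triangle -!mulrDr -mulrBr.
  by rewrite -mulrDr.
rewrite (eq_bigr _ (fun v _ => E v)) {E} !big_split /= sumrN.
have Q1 : \sum_(v <- short_vectors M) c v * q (rot6 v) x =
    \sum_(v <- short_vectors M) c v * q v x.
  rewrite -(sum_short_vectors_rot6 M (fun v => c v * q v x)).
  by apply: eq_bigr => v _; rewrite crot.
have Q2 : \sum_(v <- short_vectors M) c v * q (rot6 (rot6 v)) x =
    \sum_(v <- short_vectors M) c v * q v x.
  rewrite -[RHS]Q1 -(sum_short_vectors_rot6 M (fun v => c v * q (rot6 v) x)).
  by apply: eq_bigr => v _; rewrite crot.
have Q3 : \sum_(v <- short_vectors M) c v * q (- v) x =
    \sum_(v <- short_vectors M) c v * q v x.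
  rewrite -(sum_short_vectors_opp M (fun v => c v * q v x)).
  by apply: eq_bigr => v _; rewrite copp.
have Q4 : \sum_(v <- short_vectors M) c v * q (- v) (x + v) =
    - \sum_(v <- short_vectors M) c v * q v x.
  rewrite -sumrN; apply: eq_bigr => v _.
  by rewrite /q addrK crossC mulrN.
have E3 : \sum_(v <- short_vectors M) c v * (q (rot6 (rot6 v)) (x + v) - q (rot6 (rot6 v)) x)
   = \sum_(v <- short_vectors M) c v * q (rot6 (rot6 v)) (x + v)
     - \sum_(v <- short_vectors M) c v * q v x.
  by rewrite -[in RHS]Q2 -sumrB; apply: eq_bigr => v _; rewrite mulrBr.
have E4 : \sum_(v <- short_vectors M) - (c v / 2) * (q (- v) (x + v) - q (- v) x) =
    - (\sum_(v <- short_vectors M) c v * q (- v) (x + v)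
       - \sum_(v <- short_vectors M) c v * q (- v) x) / 2.
  rewrite -sumrB -sumrN mulr_suml; apply: eq_bigr => v _.
  by move: (c v) (q _ _) (q _ _) => *; ring.
rewrite E3 E4 Q1 Q3 Q4.
move: (\sum_(v <- _) _) (\sum_(v <- _) _) (\sum_(v <- _) _) (\sum_(v <- _) _).
by move=> *; field.
Qed.

Lemma perturbed_power_le {R : realType} (b0 b M : R)
    (d : int * int -> 'rV[R]_2) (x v : int * int) :
  let Y z := hexpt z + d z in
  b0 <= 2 -> 0 <= b -> (forall z i, `|d z 0 i| <= (b0 - 1) / 2400) ->
  v \in short_vectors M -> sqnorm (Y (x + v) - Y x) `^ (- b) <= (1 / 2) `^ (- b).
Proof.
move=> Y b02 b0b dB vV.
pose e := (b0 - 1) / 1200.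
have v1 : 1 <= sqnorm (hexpt v) :> R.
  by move: vV; rewrite in_short_vectors => /andP[v0 _]; exact: sqnorm_hexpt_ge1.
have uB i : `|(d (x + v) - d x) 0 i| <= e.
  rewrite !mxE; apply: le_trans (ler_normB _ _) _.
  by have := dB (x + v) i; have := dB x i; rewrite /e; lra.
have -> : Y (x + v) - Y x = hexpt v + (d (x + v) - d x).
  exact: hexpt_perturbed_sub.
have e1 : e <= 1 by rewrite /e; lra.
have := sqnorm_perturb _ _ e _ erefl v1 e1 uB.
rewrite ler_norml => /andP[low _].
have half : 1 / 2 <= sqnorm (hexpt v + (d (x + v) - d x)).
  move: low; rewrite lerBrDr => low.
  have : 1 / 2 <= sqnorm (hexpt v + (d (x + v) - d x)) / sqnorm (hexpt v).
    by apply: le_trans low; rewrite /e; lra.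
  by rewrite ler_pdivlMr; lra.
have h0 : (0 : R) < 1 / 2 by lra.
rewrite !powRN lef_pV2 ?posrE ?powR_gt0 //; last exact: lt_le_trans half.
by apply: ge0_ler_powR => //; rewrite nnegrE ltW // (lt_le_trans h0).
Qed.

(** Summing the triangle inequality over all the triangles x, x + v, x + omega v
and averaging over D r: the sides give three times the mean on the right and
the areas average to zero.  The displacements are bounded by half of
(b0 - 1) / 1200, the bound on their differences in the triangle
inequality. *)
Lemma mean_inverse_power_ge {R : realType} (b0 b M : R)
    (d : int * int -> 'rV[R]_2) (D : R -> {fset int * int}) :
  let g (x : 'rV[R]_2) := sqnorm x `^ (- b) in
  let Y z := hexpt z + d z in
  1 < b0 -> b0 <= 2 -> b0 <= b ->
  (forall z i, `|d z 0 i| <= (b0 - 1) / 2400) ->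
  folner D -> (\forall r \near +oo, (0 < #|` D r|)%N) ->
  exists2 E : R -> R, E r @[r --> +oo] --> (0 : R) &
    \forall r \near +oo, \sum_(v <- short_vectors M) g (hexpt v) - E r
      <= mean (D r) (fun x => \sum_(v <- short_vectors M) g (Y (x + v) - Y x)).
Proof.
move=> g Y b01 b02 b0b dB folD Dpos.
pose e := (b0 - 1) / 1200.
have V1 v : v \in short_vectors M -> 1 <= sqnorm (hexpt v) :> R.
  by rewrite in_short_vectors => /andP[v0 _]; exact: sqnorm_hexpt_ge1.
have uB x y i : `|(d x - d y) 0 i| <= e.
  rewrite !mxE; apply: le_trans (ler_normB _ _) _.
  by have := dB x i; have := dB y i; rewrite /e; lra.
have YE x v : Y (x + v) - Y x = hexpt v + (d (x + v) - d x).
  exact: hexpt_perturbed_sub.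
pose F v x := g (Y (x + v) - Y x).
have FB v x : v \in short_vectors M -> `|F v x| <= (1 / 2) `^ (- b).
  move=> vV; rewrite ger0_norm ?powR_ge0 //.
  by apply: (perturbed_power_le b0 b M d) => //; lra.
pose N (v : int * int) : R := sqnorm (hexpt v).
pose c v := 3 * b * N v `^ (- b) / (Num.sqrt 3 / 2 * N v).
have crot v : c (rot6 v) = c v by rewrite /c /N sqnorm_rot6.
have tri v x : v \in short_vectors M ->
    3 * g (hexpt v) - c v * (cross (Y (x + v) - Y x) (Y (x + rot6 v) - Y x)
     - cross (hexpt v) (hexpt (rot6 v))) <=
    F v x + F (rot6 (rot6 v)) (x + v) + F (- rot6 v) (x + rot6 v).
  move=> vV.
  have := triangle_inequality b0 b e (N v) (hexpt v) (hexpt (rot6 v))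
    (d (x + v) - d x) (d (x + rot6 v) - d x) b01 b02 b0b erefl (V1 v vV) erefl
    (sqnorm_rot6 v).
  rewrite -hexptN -hexptD -rot6_rot6 !sqnorm_rot6 => /(_ erefl (cross_rot6 v)).
  move=> /(_ (uB _ _) (uB _ _)).
  have -> : d (x + rot6 v) - d x - (d (x + v) - d x) = d (x + rot6 v) - d (x + v).
    by rewrite opprB addrA subrK.
  move=> /(_ (uB _ _)).
  rewrite /F /g !YE rot6_triangle.
  have -> : hexpt (- rot6 v) + (d (x + rot6 v - rot6 v) - d (x + rot6 v)) =
    - (hexpt (rot6 v) + (d (x + rot6 v) - d x)).
    by rewrite addrK hexptN -(opprB (d (x + rot6 v)) (d x)) -opprD.
  by rewrite sqnormN.
have null := mean_nullD D _ _
  (mean_null_triangle_sides D M _ F folD FB)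
  (mean_null_triangle_areas D M _ d c folD dB crot).
set phi := (fun x => _) in null.
exists (fun r => 3^-1 * mean (D r) phi).
  by rewrite -[X in _ --> X](mulr0 3^-1); apply: cvgMr.
near=> r.
have Dr : (0 : R) < #|` D r|%:R by rewrite ltr0n; near: r.
have : 3 * \sum_(v <- short_vectors M) g (hexpt v) <=
    3 * mean (D r) (fun x => \sum_(v <- short_vectors M) F v x) + mean (D r) phi.
  rewrite /mean mulrA -mulrDl ler_pdivlMr // [in leRHS]mulr_sumr -big_split /=.
  rewrite card_fset_sum1 natr_sum mulr_sumr; apply: ler_sum => x _.
  rewrite mulr1 /phi addrA addrCA subrr addr0 -lerBlDr mulr_sumr -sumrB.
  by rewrite big_seq [leRHS]big_seq; apply: ler_sum => v vV; exact: tri.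
rewrite /F; move: (mean _ _) (mean _ _) (\sum_(v <- _) _) => m1 m2 m3; lra.
Unshelve. all: by end_near.
Qed.

(** * Comparison of the energies *)

Lemma hex_lattice_range {R : realType} : hex_lattice R = range (@hexpt R).
Proof.
apply/seteqP; split => [_ [m [n ->]]|_ [[m n] _ <-]]; first by exists (m, n).
by exists m, n.
Qed.

Lemma perturbed_lattice_range {R : realType} (p : 'rV[R]_2 -> 'rV[R]_2) :
  perturbed_lattice p = range (fun z => hexpt z + p (hexpt z)).
Proof.
rewrite /perturbed_lattice hex_lattice_range.
apply/seteqP; split => [_ [_ [z _ <-] <-]|_ [z _ <-]]; first by exists z.
by exists (hexpt z) => //; exists z.
Qed.

Lemma perturbation_coord_le {R : realType} (p : 'rV[R]_2 -> 'rV[R]_2) (eps : R) z i :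
  (perturbation_norm p <= eps%:E)%E -> `|p (hexpt z) 0 i| <= eps.
Proof.
move=> peps.
have h : eucl_norm (p (hexpt z)) <= eps.
  rewrite -lee_fin; apply: le_trans peps; apply: ereal_sup_ubound.
  by exists (hexpt z) => //; rewrite hex_lattice_range; exists z.
apply: le_trans h; rewrite eucl_normE -sqrtr_sqr ler_sqrt ?sqnorm_ge0 //.
have [->|->] := ord2_cases i.
- by rewrite lerDl sqr_ge0.
- by rewrite lerDr sqr_ge0.
Qed.

(** Distinct lattice points are at distance at least 1. *)
Lemma perturbation_injective {R : realType} (d : int * int -> 'rV[R]_2) :
  (forall z i, `|d z 0 i| <= 1 / 4) -> injective (fun z => hexpt z + d z).
Proof.
move=> dB z w /= Yzw; apply/eqP; rewrite -subr_eq0; apply/negPn/negP => zw.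
have := @sqnorm_hexpt_ge1 R _ zw.
have -> : hexpt (z - w) = d w - d z.
  rewrite hexptD hexptN; apply/eqP.
  by rewrite subr_eq addrAC eq_sym subr_eq eq_sym Yzw addrC.
have dd i : `|(d w - d z) 0 i| <= 1 / 2.
  rewrite !mxE; apply: le_trans (ler_normB _ _) _.
  by have := dB w i; have := dB z i; lra.
rewrite /sqnorm; have := dd 0; have := dd 1.
move: (_ 0 0) (_ 0 1) => x y; rewrite !ler_norml => /andP[? ?] /andP[? ?] ?.
clear Yzw; nra.
Qed.

Lemma hexpt_near {R : realType} : near_lattice (@hexpt R).
Proof. by move=> z i; rewrite subrr normr0. Qed.

Lemma hexpt_inj {R : realType} : injective (@hexpt R).
Proof.
move=> z w zw; pose d0 (y : int * int) := 0 : 'rV[R]_2.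
have d0B y i : `|d0 y 0 i| <= 1 / 4 by rewrite mxE normr0; lra.
by apply: (perturbation_injective d0 d0B) => /=; rewrite zw.
Qed.

Lemma mean_le {R : realType} (D : {fset int * int}) (phi : int * int -> R) (c : R) :
  0 <= c -> (forall x, x \in D -> phi x <= c) -> mean D phi <= c.
Proof.
move=> c0 phic; rewrite /mean.
(* the mean over the empty set is 0 / 0 = 0 *)
have [->|D0] := eqVneq D fset0.
  by rewrite cardfs0 invr0 mulr0.
rewrite ler_pdivrMr; last by rewrite ltr0n cardfs_gt0.
rewrite card_fset_sum1 natr_sum mulr_sumr big_seq [leRHS]big_seq.
by apply: ler_sum => x xD; rewrite mulr1; exact: phic.
Qed.

Lemma sqnorm_sub_le {R : realType} (x y : 'rV[R]_2) :
  sqnorm (x - y) <= 2 * sqnorm x + 2 * sqnorm y.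
Proof.
rewrite /sqnorm !mxE; have := sqr_ge0 (x 0 0 + y 0 0).
have := sqr_ge0 (x 0 1 + y 0 1); lra.
Qed.

(** Two points of the disk of radius r differ by a vector of squared length at
most 4 r^2, and for a given x the differences x - y are distinct. *)
Lemma hex_energy_in_disk_le {R : realType} (s r : R) : 0 <= r ->
  energy_in_disk (inverse_power s) (hex_lattice R) r <=
  \sum_(v <- short_vectors (4 * r ^+ 2)) sqnorm (hexpt v) `^ (- (s / 2)).
Proof.
move=> r0; rewrite hex_lattice_range.
rewrite (energy_in_disk_range _ _ _ hexpt_near hexpt_inj r0).
apply: mean_le; first by apply: sumr_ge0 => v _; exact: powR_ge0.
move=> x; rewrite (in_indices _ _ _ hexpt_near) => xr.
under eq_bigr => y _ do rewrite inverse_powerE -hexptN -hexptD.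
rewrite -(big_map (fun y => x - y) xpredT (fun v => sqnorm (hexpt v) `^ (- (s / 2)))).
apply: ler_sum_uniq_subset.
- by rewrite map_inj_uniq ?fset_uniq // => y z /addrI /oppr_inj.
- exact: fset_uniq.
- move=> _ /mapP[y yD ->]; move: yD.
  rewrite !inE (in_indices _ _ _ hexpt_near) => /andP[yx yr].
  rewrite in_short_vectors subr_eq0 eq_sym yx /= hexptD hexptN.
  apply: le_trans (sqnorm_sub_le _ _) _; lra.
- by move=> v; exact: powR_ge0.
Qed.

(** The energy in the disk of radius r is at least the truncated lattice sum
minus E r + bd r, where E r bounds the defect of telescoping and bd r counts
the pairs cut by the boundary of the disk. *)
Lemma energy_perturbed_ge {R : realType} (b0 s M : R) (p : 'rV[R]_2 -> 'rV[R]_2) :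
  1 < b0 -> b0 <= 2 -> b0 <= s / 2 ->
  (perturbation_norm p <= ((b0 - 1) / 2400)%:E)%E ->
  ((\sum_(v <- short_vectors M) sqnorm (hexpt v) `^ (- (s / 2)))%:E
    <= energy (inverse_power s) (perturbed_lattice p))%E.
Proof.
move=> b01 b02 b0s pB.
pose d z := p (hexpt z).
pose Y z := hexpt z + d z.
have dB z i : `|d z 0 i| <= (b0 - 1) / 2400 := perturbation_coord_le p _ z i pB.
have nY : near_lattice Y.
  move=> z i; rewrite mxE addrAC subrr add0r.
  by apply: le_trans (dB z i) _; lra.
have injY : injective Y.
  apply: perturbation_injective => z i; apply: le_trans (dB z i) _; lra.
pose D (r : R) := indices_in_disk Y r.
have folD : folner D by move=> w; exact: boundary_negligible.
have Dpos : \forall r \near +oo, (0 < #|` D r|)%N.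
  near=> r; rewrite -(ltr0n R).
  have r4 : 4 <= r by near: r; apply: nbhs_pinfty_ge; rewrite num_real.
  apply: lt_le_trans (card_indices_ge Y r nY r4).
  by rewrite divr_gt0 // exprn_gt0 //; lra.
pose g (x : 'rV[R]_2) := sqnorm x `^ (- (s / 2)).
have [E E0 EE] := mean_inverse_power_ge b0 (s / 2) M d D b01 b02 b0s dB folD Dpos.
have V0 : 0 \notin @short_vectors R M by rewrite in_short_vectors eqxx.
have gN x : g (- x) = g x by rewrite /g sqnormN.
pose B := (1 / 2 : R) `^ (- (s / 2)).
have gB x v : v \in short_vectors M -> g (Y (x + v) - Y x) <= B.
  by move=> vV; apply: (perturbed_power_le b0 (s / 2) M d) => //; lra.
pose bd r : R := \sum_(v <- @short_vectors R M) B * (#|` boundary (D r) v|%:R / #|` D r|%:R).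
have bd0 : bd r @[r --> +oo] --> (0 : R).
  rewrite /bd; elim: (enum_fset (short_vectors M)) => [|v V IH].
    rewrite (_ : (fun r => _) = fun=> 0); first exact: cvg_cst.
    by apply/funext => r; rewrite big_nil.
  rewrite (_ : (fun r => _) = fun r =>
      B * (#|` boundary (D r) v|%:R / #|` D r|%:R)
      + \sum_(w <- V) B * (#|` boundary (D r) w|%:R / #|` D r|%:R)).
    rewrite -[X in _ --> X](_ : B * 0 + 0 = 0); last by rewrite mulr0 addr0.
    by apply: cvgD => //; apply: cvgMr => //; exact: folD.
  by apply/funext => r; rewrite big_cons.
have tot : (E r + bd r) @[r --> +oo] --> (0 : R).
  by rewrite -[X in _ --> X](addr0 0); apply: cvgD.
rewrite perturbed_lattice_range /energy limf_einfE.
apply/lee_subgt0Pr => eta eta0.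
pose W := [set r | \sum_(v <- short_vectors M) g (hexpt v) - eta
   <= energy_in_disk (inverse_power s) (range Y) r].
have WW : \forall r \near +oo, W r.
  have /cvgr0Pnorm_le /(_ eta eta0) small := tot.
  near=> r; rewrite /W /=.
  have r0 : 0 <= r by near: r; apply: nbhs_pinfty_ge; rewrite num_real.
  rewrite (energy_in_disk_range _ _ _ nY injY r0).
  have -> : (fun x => \sum_(y <- (D r `\ x)%fset) inverse_power s (eucl_norm (Y x - Y y)))
      = (fun x => \sum_(y <- (D r `\ x)%fset) g (Y x - Y y)).
    by apply/funext => x; apply: eq_bigr => y _; rewrite inverse_powerE.
  apply: le_trans (energy_lower_bound g Y (D r) (short_vectors M) B V0
    (fun x => powR_ge0 _ _) gN gB).
  have /ler_normlP[_ smallr] : `|E r + bd r| <= eta by near: r.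
  have Er : \sum_(v <- short_vectors M) g (hexpt v) - E r
      <= mean (D r) (fun x => \sum_(v <- short_vectors M) g (Y (x + v) - Y x)).
    by near: r.
  rewrite -/(bd r).
  move: (mean _ _) (bd r) (E r) (\sum_(v <- _) _) Er smallr => *; lra.
apply: (@le_trans _ _ (ereal_inf
  ((fun r => (energy_in_disk (inverse_power s) (range Y) r)%:E) @` W))).
  by apply: le_ereal_inf_tmp => _ [r Wr <-]; rewrite -EFinB lee_fin.
by apply: ereal_sup_ubound; exists W.
Unshelve. all: by end_near.
Qed.

Lemma compact_gt_uniform {R : realType} (K : set R) (a : R) :
  compact K -> K `<=` [set s | a < s] -> exists2 m, a < m & K `<=` [set s | m <= s].
Proof.
move=> cK Ka; have [->|K0] := eqVneq K set0.
  by exists (a + 1); rewrite ?ltrDl // => s [].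
have [m mK mmin] : exists2 m, m \in K & forall t, t \in K -> m <= t.
  apply: (@compact_EVT_min _ _ id K) => //; first exact/set0P.
  by apply: continuous_subspaceT => x; exact: cvg_id.
exists m; first by apply: Ka; rewrite -inE.
by move=> s Ks; apply: mmin; rewrite inE.
Qed.

Theorem mainTheorem3 (R : realType) (K : set R) (Kcompact : compact K)
    (Kgt2 : K `<=` [set s | 2 < s]) :
  exists2 eps : R, 0 < eps &
    forall (s : R) (p : 'rV[R]_2 -> 'rV[R]_2),
      K s -> (perturbation_norm p <= eps%:E)%E ->
      (energy (inverse_power s) (hex_lattice R)
         <= energy (inverse_power s) (perturbed_lattice p))%E.
Proof.
have [m m2 Km] := compact_gt_uniform K 2 Kcompact Kgt2.
pose b0 := Num.min 2 (m / 2).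
have b01 : 1 < b0 by rewrite lt_min; apply/andP; split; lra.
have b02 : b0 <= 2 by rewrite ge_min lexx.
exists ((b0 - 1) / 2400); first by move: (b0) b01 => c c1; lra.
move=> s p Ks pB.
have b0s : b0 <= s / 2.
  rewrite ge_min; apply/orP; right; have := Km _ Ks => /= ms; lra.
rewrite {1}/energy limf_einfE; apply: ge_ereal_sup => _ [W WF <-].
have [r [Wr r0]] : exists r : R, W r /\ 0 <= r.
  near (pinfty_nbhs R) => r; exists r; split; first by near: r.
  by near: r; apply: nbhs_pinfty_ge; rewrite num_real.
apply: le_trans (energy_perturbed_ge b0 s (4 * r ^+ 2) p b01 b02 b0s pB).
apply: (@le_trans _ _ (energy_in_disk (inverse_power s) (hex_lattice R) r)%:E).
  by apply: ereal_inf_lbound; exists r.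
by rewrite lee_fin hex_energy_in_disk_le.
Unshelve. all: by end_near.
Qed.
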